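(* Let $\mu$ be a probability measure on $\mathbb{R}^2$ whose support is a finite set $F$ with $(0,0)\in F$ (so $\mu(\{(0,0)\})>0$) and such that every other point $(x,y)\in F$ satisfies $x>0$ and $y>0$. Let $\{A_\omega\}$ be the random family of tridiagonal operators on $l^2(\mathbb{Z})$ with zero diagonal generated by $\mu$ as described in the context. The eigenvalues of the operator $A_\omega$ are almost surely all real. However, the spectrum of $A_\omega$ almost surely contains the interior of the ellipse \[ E=\{xe^{i\theta}+ye^{-i\theta}:\theta\in[0,2\pi]\} \] for every non-zero $(x,y)\in F$.
   Context: The pairs $(A_{n+1,n},A_{n,n+1})$, $n\in\mathbb{Z}$, are independent random vectors in $\mathbb{R}^2$ with common law $\mu$; $A_{m,n}=0$ whenever $m=n$ or $|m-n|>1$; and $A_\omega$ is the resulting bounded operator $(A_\omega f)_m=\sum_n A_{m,n}f_n$ on $l^2(\mathbb{Z})$. The interior of the ellipse $E$ is the open bounded region of $\mathbb{C}$ enclosed by the curve $E$ (empty when $x=y$, in which case $E$ is a line segment). *)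

(* Defs.v *)
From HB Require Import structures.
From mathcomp Require Import all_boot all_order all_algebra.
From mathcomp Require Import finmap complex.
From mathcomp Require Import all_classical all_reals all_analysis.

Set Implicit Arguments.
Unset Strict Implicit.
Unset Printing Implicit Defensive.

Import Order.TTheory GRing.Theory Num.Theory numFieldNormedType.Exports.

Local Open Scope classical_set_scope.
Local Open Scope ring_scope.
Local Open Scope complex_scope.

Section probability_notions.
Context {R : realType}.

(* Topological support: open subsets of the plane belong to the product
   sigma-algebra on R * R, so mu is only evaluated on measurable sets. *)
Definition support_of (mu : probability (R * R)%type R) : set (R * R) :=
  [set p | forall U : set (R * R), open U -> U p -> (0 < mu U)%E].

Definition mutually_independent (I : choiceType) (d d' : measure_display)
    (T : measurableType d) (T' : measurableType d') (P : probability T R)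
    (X : I -> {RV P >-> T'}) : Prop :=
  forall (J : {fset I}) (B : I -> set T'),
    (forall i, i \in J -> measurable (B i)) ->
    P (\bigcap_(i in [set` J]) (X i @^-1` B i)) =
    (\prod_(i <- J) P (X i @^-1` B i))%E.

(* Equality of laws is only required on measurable sets: the values of a
   measure on non-measurable sets carry no meaning. *)
Definition has_law (d d' : measure_display) (T : measurableType d)
    (T' : measurableType d') (P : probability T R) (X : {RV P >-> T'})
    (mu : probability T' R) : Prop :=
  forall B : set T', measurable B -> distribution P X B = mu B.

End probability_notions.

Section operators_on_l2.
Context {R : realType}.

Definition l2sum (f : int -> R[i]) : \bar R :=
  (\esum_(n in [set: int]) (Normc.normc (f n) ^+ 2)%:E)%E.

Definition l2 : set (int -> R[i]) := [set f | (l2sum f < +oo)%E].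

Definition l2norm (f : int -> R[i]) : R := Num.sqrt (fine (l2sum f)).

(* Operators are given by functions on all sequences; only their action on
   l2 matters below. *)
Definition bounded_operator (T : (int -> R[i]) -> (int -> R[i])) : Prop :=
  [/\ forall f, l2 f -> l2 (T f),
      forall (c : R[i]) (f g : int -> R[i]), l2 f -> l2 g ->
        T (c *: f + g) = c *: T f + T g
    & exists C : R, forall f, l2 f -> l2norm (T f) <= C * l2norm f].

Definition eigenvalues (T : (int -> R[i]) -> (int -> R[i])) : set R[i] :=
  [set l | exists f : int -> R[i], [/\ l2 f, f <> 0 & T f = l *: f]].

Definition resolvent_set (T : (int -> R[i]) -> (int -> R[i])) : set R[i] :=
  [set l | exists2 S : (int -> R[i]) -> (int -> R[i]), bounded_operator S &
    forall f, l2 f -> T (S f) - l *: S f = f /\ S (T f - l *: f) = f].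

Definition spectrum (T : (int -> R[i]) -> (int -> R[i])) : set R[i] :=
  ~` resolvent_set T.

(* The sum over int is a finite-support sum, which is the intended one for
   matrices with finitely many nonzero entries in each row. *)
Definition matrix_operator (a : int -> int -> R) (f : int -> R[i]) :
    int -> R[i] :=
  fun m => \sum_(n \in [set: int]) (a m n)%:C * f n.

(* x n encodes the pair of entries (A_{n+1,n}, A_{n,n+1}). *)
Definition tridiagonal (x : int -> R * R) (m n : int) : R :=
  if m == n + 1 then (x n).1 else if n == m + 1 then (x m).2 else 0.

End operators_on_l2.

Section ellipse.
Context {R : realType}.

Definition expi (t : R) : R[i] := cos t +i* sin t.

Definition ellipse (p : R * R) : set R[i] :=
  [set p.1%:C * expi t + p.2%:C * expi (- t) | t in `[0, 2 * pi]].

(* The region enclosed by a curve: the union of the bounded connected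
   components of its complement. The annotation R[i]^o selects the usual
   (norm) topology of the complex plane. *)
Definition enclosed_region (E : set R[i]) : set R[i] :=
  [set z | ~ E z /\
    bounded_set (connected_component (~` E : set R[i]^o) (z : R[i]^o))].

End ellipse.

(* Main.v *)
Require Import Defs.
From HB Require Import structures.
From mathcomp Require Import all_boot all_order all_algebra.
From mathcomp Require Import finmap complex.
From mathcomp Require Import all_classical all_reals all_analysis.
From mathcomp Require Import ring lra zify.

(** A zero pair [X a = (0, 0)] cuts the operator between the sites [a] and
    [a + 1]. Since [mu] charges (0, 0), independence forces such cuts to occur
    almost surely infinitely often in both directions, so an eigenvector is
    carried by finite blocks. There the two off-diagonal entries of an edge
    vanish together or are both positive, so a diagonal change of scale makes
    the block symmetric, and the eigenvalue is real ([eigenvalue_real]).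

    The spectrum is larger because the resolvent of long blocks is not
    controlled by their eigenvalues. By [recurrent_pattern], almost surely each
    [p] in [F] is repeated [N] times in a row immediately after a zero pair, for
    every [N], and likewise immediately before one. On such a run the eigenvalue
    equation is the recurrence [p.1 * h k + p.2 * h k.+2 = l * h k.+1]. For [l]
    inside the ellipse, [enclosed_region_roots] shows that its characteristic
    roots lie on the same side of the unit circle. If both are inside, the
    solution with [h 0 = 0] and [h 1 = 1] decays, and its restriction to the run
    satisfies the eigenvalue equation except for small errors at the last sites
    ([quasimode_on_run]); if both are outside, the mirror image works. Vectors
    of norm at least 1 that [A - l] makes arbitrarily small rule out a bounded
    inverse ([quasimodes_in_spectrum]). *)

Set Implicit Arguments.
Unset Strict Implicit.
Unset Printing Implicit Defensive.

Import Order.TTheory GRing.Theory Num.Theory numFieldNormedType.Exports.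

Local Open Scope classical_set_scope.
Local Open Scope ring_scope.
Local Open Scope complex_scope.

(** * Recurrence of finite patterns in an independent sequence *)

Lemma measurable_point (R : realType) (q : R * R) : measurable [set q].
Proof.
have -> : [set q] = [set q.1] `*` [set q.2].
  by apply/seteqP; split => [x ->//|[x y] /= [-> ->]]; case: q.
exact: measurableX.
Qed.

Section recurrence.
Context (R : realType) (d : measure_display) (Omega : measurableType d)
  (P : probability Omega R).

Lemma le0_of_le_expr (r x : R) : 0 <= x < 1 -> (forall n, r <= x ^+ n) -> r <= 0.
Proof.
move=> /andP[x0 x1] rx.
have cx : (fun n => x ^+ n) @ \oo --> 0 by apply: cvg_expr; rewrite ger0_norm.
rewrite -(cvg_lim (@Rhausdorff R) cx); apply: limr_ge.
  by apply/cvg_ex; exists 0.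
by near=> n; exact: rx.
Unshelve. all: by end_near. Qed.

(** The second Borel-Cantelli argument for trials with equal probability of
    success: the first [K] trials all fail with probability [(1 - c) ^+ K].
    The product rule is assumed for the successes only; the induction on [K]
    transfers it to the failures one trial at a time, which is why its claim
    also carries a finite set [s] of later successes. *)
Lemma independent_trials_succeed (B : nat -> set Omega) (c : R) :
  (forall k, measurable (B k)) -> 0 < c ->
  (forall s : seq nat, uniq s ->
     P (\bigcap_(k in [set` s]) B k) = (c ^+ size s)%:E) ->
  {ae P, forall w, exists k, B k w}.
Proof.
move=> mB c0 PB.
pose E K := \bigcap_(k in `I_K) ~` B k.
have ES K : E K.+1 = E K `\` B K.
  apply/seteqP; split=> w /=.
    move=> h; split; last by apply: h => /=.
    by move=> k /= kK; apply: h; exact: ltnW.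
  move=> [h hK] k /=; rewrite ltnS leq_eqVlt => /orP[/eqP -> //|]; exact: h.
have mE K : measurable (E K).
  by apply: bigcap_measurableType => k _; exact: measurableC.
have mBs (s : seq nat) : measurable (\bigcap_(k in [set` s]) B k).
  exact: bigcap_measurableType.
have PE K : forall s : seq nat, uniq s -> all (leq K) s ->
    P (E K `&` \bigcap_(k in [set` s]) B k) = ((1 - c) ^+ K * c ^+ size s)%:E.
  elim: K => [|K IH] s us /allP Ks.
    by rewrite /E II0 bigcap_set0 setTI PB// expr0 mul1r.
  rewrite ES setDE setIAC -setDE.
  set A := E K `&` _.
  have mA : measurable A by exact: measurableI.
  have -> : P (A `\` B K) = (P A - P (A `&` B K))%E.
    by apply: measureD => //; rewrite (le_lt_trans (probability_le1 _ _))// ltry.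
  rewrite /A IH//; last by apply/allP => k /Ks /ltnW.
  have -> : E K `&` (\bigcap_(k in [set` s]) B k) `&` B K =
    E K `&` \bigcap_(k in [set` K :: s]) B k.
    rewrite -setIA; congr (_ `&` _); apply/seteqP; split=> w /=.
      by move=> [h BK] k /=; rewrite inE => /orP[/eqP ->//|]; exact: h.
    by move=> h; split=> [k /= ks|]; apply: h; rewrite /= inE ?ks ?orbT ?eqxx.
  rewrite IH/=; last 2 first.
  - by rewrite us andbT; apply/negP => /Ks; rewrite ltnn.
  - by rewrite leqnn/=; apply/allP => k /Ks /ltnW.
  by rewrite -EFinB; congr (_%:E); rewrite !exprS; ring.
have c1 : c <= 1.
  have := PB [:: 0%N] isT; rewrite set_cons1 bigcap_set1 expr1 => /= PB0.
  by rewrite -lee_fin -PB0; exact: probability_le1.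
exists (\bigcap_k ~` B k); split.
- by apply: bigcapT_measurable => k; exact: measurableC.
- have mI : measurable (\bigcap_k ~` B k).
    by apply: bigcapT_measurable => k; exact: measurableC.
  set A := \bigcap_k _.
  have PA : P A = (fine (P A))%:E by rewrite fineK// fin_num_measure.
  rewrite PA; congr (_%:E); apply/eqP; rewrite eq_le fine_ge0 ?andbT//.
  apply: (@le0_of_le_expr _ (1 - c)).
    by rewrite subr_ge0 c1 ltrBlDr ltrDl.
  move=> K; rewrite -lee_fin -PA.
  have := PE K [::] isT isT; rewrite set_nil bigcap_set0 setIT expr0 mulr1 => <-.
  by apply: le_measure; rewrite ?inE// => w h k _; exact: h.
- by move=> w /= /forallNP h k _; exact: h.
Qed.

(** The sequence [X \o e] is cut into consecutive blocks of the length of [s];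
    the events that a block reads [s] are independent, and each has probability
    the product of the masses of the atoms in [s]. The reading order [e] allows
    the pattern to be searched to the right or to the left of any site. *)
Lemma recurrent_pattern (mu : probability (R * R)%type R)
    (X : int -> {RV P >-> (R * R)%type}) (e : nat -> int) (s : seq (R * R)) :
  mutually_independent X -> (forall n, has_law (X n) mu) -> injective e ->
  (forall q, q \in s -> (0 < mu [set q])%E) ->
  {ae P, forall w, exists a, forall j, (j < size s)%N ->
    X (e (a + j)%N) w = nth (0, 0) s j}.
Proof.
move=> Xi Xl einj spos; set L := size s.
have m1 := @measurable_point R.
have mX i q : measurable (X i @^-1` [set q]).
  exact: measurable_funPTI.
(* Mutual independence is about events indexed by sites, so the letter expected
   at the site [i] has to be recovered from [i] by inverting [e]. *)
pose einv i := xget 0%N [set n | e n = i].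
have eK n : einv (e n) = n.
  by apply: einj; rewrite /einv; case: xgetP => [m _ ->//|/(_ n) /(_ erefl)].
pose C i := [set nth (0, 0) s (einv i %% L)].
pose B k := \bigcap_(j in `I_L) (X (e (k * L + j)%N) @^-1` [set nth (0, 0) s j]).
pose c := \prod_(q <- s) fine (mu [set q]).
have c0 : 0 < c.
  rewrite /c big_seq; apply: prodr_gt0 => q qs; apply: fine_gt0.
  by rewrite spos//= (le_lt_trans (probability_le1 _ _))// ltry.
have mB k : measurable (B k).
  by apply: bigcap_measurableType => j _; exact: mX.
have PB (t : seq nat) : uniq t ->
     P (\bigcap_(k in [set` t]) B k) = (c ^+ size t)%:E.
  move=> ut.
  pose u := [seq (k * L + j)%N | k <- t, j <- iota 0 L].
  have modj k j : (j < L)%N -> ((k * L + j) %% L)%N = j.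
    by move=> jL; rewrite modnMDl modn_small.
  have uu : uniq u.
    apply: allpairs_uniq => //; first exact: iota_uniq.
    move=> [k j] [k' j'] /allpairsP[[a b] /= [_ + [-> ->]]].
    move=> + /allpairsP[[a' b'] /= [_ + [-> ->]]] E.
    rewrite !mem_iota /= !add0n => bL bL'.
    have bb : b = b' by rewrite -(modj a b)// E modj.
    move: E; rewrite bb => /addIn /eqP; rewrite eqn_pmul2r; last first.
      exact: leq_ltn_trans bL'.
    by move=> /eqP ->.
  pose J := [fset e n | n in u]%fset.
  have -> : \bigcap_(k in [set` t]) B k = \bigcap_(i in [set` J]) (X i @^-1` C i).
    apply/seteqP; split=> w h.
      move=> i /= /imfsetP[n /= /allpairsP[[k j] /= [kt + ->]] ->].
      rewrite mem_iota /= add0n => jL; rewrite /C/= eK modj//.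
      exact: h.
    move=> k /= kt j /= jL.
    have /h : e (k * L + j)%N \in J.
      apply/imfsetP; exists (k * L + j)%N => //=; apply/allpairsP.
      by exists (k, j); rewrite /= mem_iota add0n.
    by rewrite /C /= eK modj.
  rewrite (Xi J C)//; last by move=> i _; exact: m1.
  rewrite (perm_big [seq e n | n <- u]); last first.
    apply: uniq_perm; [exact: fset_uniq|by rewrite map_inj_uniq|].
    move=> i; apply/imfsetP/mapP => /=; by case=> n ? ?; exists n.
  rewrite big_map big_allpairs_dep/=.
  have Pc k : (\prod_(j <- iota 0 L)
      P (X (e (k * L + j)%N) @^-1` C (e (k * L + j)%N)) = c%:E)%E.
    rewrite /c (big_nth (0, 0)) /index_iota subn0 (big_morph EFin EFinM (erefl _)).
    rewrite [LHS]big_seq [RHS]big_seq; apply: eq_bigr => j.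
    rewrite mem_iota add0n => /andP[_ jL].
    rewrite fineK ?fin_num_measure// /C eK modj//; exact: (Xl _ _ (m1 _)).
  under eq_bigr do rewrite Pc.
  elim: (t) => [|k t' IH]; first by rewrite big_nil.
  by rewrite big_cons IH/= exprS EFinM.
have := independent_trials_succeed mB c0 PB.
apply: filterS => w [k Bk]; exists (k * L)%N => j jL; exact: Bk.
Qed.
End recurrence.

(** * Atoms of a law with finite support *)

Section support.
Context (R : realType) (mu : probability (R * R)%type R).

Let box (q : (rat * rat) * (rat * rat)) : set (R * R) :=
  `]ratr q.1.1, ratr q.1.2[%classic `*` `]ratr q.2.1, ratr q.2.2[%classic.

Let measurable_box q : measurable (box q).
Proof. by apply: measurableX; exact: measurable_itv. Qed.

Let nbhs_rat_itv (x : R) (A : set R) : nbhs x A ->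
  exists q : rat * rat, (x \in `]ratr q.1, ratr q.2[) /\
    `]ratr q.1, ratr q.2[%classic `<=` A.
Proof.
move=> /nbhs_ballP[e /= e0 eA].
have [a] : exists a : rat, ratr a \in `]x - e, x[.
  by apply: rat_in_itvoo; rewrite ltrBlDr ltrDl.
have [b] : exists b : rat, ratr b \in `]x, x + e[.
  by apply: rat_in_itvoo; rewrite ltrDl.
rewrite !in_itv/= => /andP[xb be] /andP[ea ax].
exists (a, b); rewrite in_itv/= ax xb; split => // y /=.
rewrite in_itv/= => /andP[ay yb].
apply: eA; rewrite /ball/= ltr_norml; apply/andP; split; lra.
Qed.

Let nbhs_box (p : R * R) (A : set (R * R)) : nbhs p A ->
  exists q, box q p /\ box q `<=` A.
Proof.
move=> [[A1 A2] /= [/nbhs_rat_itv[q1 [p1 qA1]] /nbhs_rat_itv[q2 [p2 qA2]]] AA].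
exists (q1, q2); split; first by split.
by move=> x [/qA1 x1 /qA2 x2]; apply: AA.
Qed.

Lemma open_measurable_plane (U : set (R * R)) : open U -> measurable U.
Proof.
move=> oU; have -> : U = \bigcup_(q in [set q | box q `<=` U]) box q.
  apply/seteqP; split=> [p Up|p [q /= qU /qU //]].
  have [q [qp qU]] : exists q, box q p /\ box q `<=` U.
    by apply: nbhs_box; exact: open_nbhs_nbhs.
  by exists q.
by rewrite bigcup_mkcond; apply: countable_bigcupT_measurable => // q; case: ifP.
Qed.

(** Every point off the support has a null neighbourhood, hence lies in a null
    rational box, and there are only countably many such boxes. *)
Lemma negligible_setC_support : mu.-negligible (~` support_of mu).
Proof.
pose N k := if @choice.unpickle (rat * rat * (rat * rat))%type k is Some q then
  if mu (box q) == 0%E then box q else set0 else set0.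
apply: (@negligibleS _ _ _ _ (\bigcup_k N k)); last first.
  apply: negligible_bigcup => k; rewrite /N; case: choice.unpickle => [q|];
    last exact: negligible_set0.
  case: ifPn => [/eqP q0|_]; last exact: negligible_set0.
  exact/negligibleP.
move=> p /existsNP[U /not_implyP[oU /not_implyP[Up /negP]]].
rewrite -leNgt => U0.
have [q [qp qU]] : exists q, box q p /\ box q `<=` U.
  by apply: nbhs_box; exact: open_nbhs_nbhs.
have [k kq] : exists k, choice.unpickle k = Some q.
  by exists (choice.pickle q); exact: choice.pickleK.
exists k => //; rewrite /N kq ifT// -measure_le0.
apply: le_trans U0; apply: le_measure; rewrite ?inE//.
exact: open_measurable_plane.
Qed.

(** The complement of the other points of the support is an open neighbourhood
    of [p], so it has positive mass; almost all of this mass is at [p]. *)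
Lemma support_atom (p : R * R) : finite_set (support_of mu) ->
  support_of mu p -> (0 < mu [set p])%E.
Proof.
move=> Ffin Fp.
have m1 := measurable_point p.
have cF : closed (support_of mu `\ p).
  apply: (accessible_finite_set_closed.1 _ _ _).
    exact/hausdorff_accessible/norm_hausdorff.
  exact: finite_setD.
pose U := ~` (support_of mu `\ p).
have oU : open U by exact: closed_openC.
have /(Fp _ oU) : U p by move=> [_]; exact.
have [N [mN N0 FN]] := negligible_setC_support.
move=> /lt_le_trans; apply; rewrite -[leRHS]adde0 -N0.
apply: le_trans (measureU2 _ _ _) => //.
apply: le_measure; rewrite ?inE//; first exact: open_measurable_plane.
  exact: measurableU.
move=> q /= Uq; have [->|/eqP qp] := eqVneq q p; first by left.
by right; apply: FN => Fq; apply: Uq.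
Qed.
End support.

(** * Quasimodes and spectrum *)

Section l2.
Context (R : realType).
Implicit Types (f g : int -> R[i]) (x : int -> R * R).

Lemma matrix_operator_tridiagonal x f m :
  matrix_operator (tridiagonal x) f m =
  (x (m - 1)).1%:C * f (m - 1) + (x m).2%:C * f (m + 1).
Proof.
rewrite /matrix_operator (fsbigTE [fset (m - 1)%R; (m + 1)%R]%fset); last first.
  move=> n; rewrite !inE negb_or => /andP[n1 n2]; rewrite /tridiagonal.
  rewrite ifF ?ifF ?mul0r//; first exact/negbTE.
  by apply/negbTE; apply: contra n1 => /eqP ->; rewrite addrK.
rewrite big_fsetU1/=; last by rewrite inE; lia.
rewrite big_seq_fset1 /tridiagonal subrK eqxx eqxx ifF//.
by apply/negbTE; lia.
Qed.

Lemma l2sum_finite_support f (s : seq int) : uniq s ->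
  (forall n, n \notin s -> f n = 0) ->
  l2sum f = (\sum_(n <- s) Normc.normc (f n) ^+ 2)%:E.
Proof.
move=> us f0; rewrite /l2sum.
transitivity (\esum_(n in [set` s]) (Normc.normc (f n) ^+ 2)%:E)%E.
  rewrite [RHS]esum_mkcond; apply: eq_esum => n _; case: ifPn => //.
  by rewrite mem_setE => /f0 ->; rewrite Normc.normc0 expr0n.
rewrite esum_fset; [|exact: finite_seq|by move=> n _; rewrite lee_fin sqr_ge0].
by rewrite -fsbig_seq// -sumEFin.
Qed.

Lemma l2_finite_support f (s : seq int) : uniq s ->
  (forall n, n \notin s -> f n = 0) -> l2 f.
Proof. by move=> us f0; rewrite /l2/= (l2sum_finite_support us f0) ltry. Qed.

Lemma normc_ge0 (z : R[i]) : 0 <= Normc.normc z.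
Proof. by case: z => a b; exact: sqrtr_ge0. Qed.

Lemma l2norm_ge f (s : seq int) m : uniq s ->
  (forall n, n \notin s -> f n = 0) -> m \in s ->
  Normc.normc (f m) <= l2norm f.
Proof.
move=> us f0 ms; rewrite /l2norm (l2sum_finite_support us f0)/=.
rewrite -[leLHS]ger0_norm ?normc_ge0// -sqrtr_sqr ler_sqrt; last first.
  by apply: sumr_ge0 => n _; exact: sqr_ge0.
by rewrite (big_rem m)//= lerDl; apply: sumr_ge0 => n _; exact: sqr_ge0.
Qed.

Lemma l2norm_pair_le f m n : m != n ->
  (forall k, k != m -> k != n -> f k = 0) ->
  l2norm f <= Normc.normc (f m) + Normc.normc (f n).
Proof.
move=> mn f0; rewrite /l2norm (@l2sum_finite_support f [:: m; n]); first last.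
- by move=> k; rewrite !inE negb_or => /andP[]; exact: f0.
- by rewrite /= inE mn.
rewrite /= big_cons big_seq1 -[leRHS]ger0_norm ?addr_ge0 ?normc_ge0//.
rewrite -sqrtr_sqr ler_sqrt ?sqr_ge0// sqrrD lerD2r lerDl.
by rewrite mulrn_wge0// mulr_ge0// normc_ge0.
Qed.

Lemma l2sum_opp f : l2sum (f \o -%R) = l2sum f.
Proof.
by rewrite /l2sum [RHS](@reindex_esum _ _ _ [set: int] [set: int] -%R)//.
Qed.

(** Approximate eigenvectors, normalised by a lower bound on the norm because the
    ones built on runs are only known to take the value 1 somewhere. *)
Definition has_quasimodes (T : (int -> R[i]) -> int -> R[i]) (l : R[i]) :=
  forall e : R, 0 < e -> exists f, [/\ l2 f, l2 (T f - l *: f), 1 <= l2norm f &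
    l2norm (T f - l *: f) <= e].

(** A resolvent [S] maps [T f - l *: f] back to [f], so the bound on [S] keeps
    these vectors away from 0. *)
Lemma quasimodes_in_spectrum T l : has_quasimodes T l -> spectrum T l.
Proof.
move=> qT [S [_ _ [C SC]] TS].
have C0 : 0 < `|C| + 1 by rewrite ltr_wpDl.
have [|f [l2f l2g f1 ge]] := qT (2^-1 / (`|C| + 1)).
  by rewrite divr_gt0.
have /SC := l2g; rewrite (TS f l2f).2 => fC.
have : l2norm f <= 2^-1.
  apply: (le_trans fC); apply: (@le_trans _ _ ((`|C| + 1) * l2norm (T f - l *: f))).
    rewrite ler_wpM2r ?sqrtr_ge0//; have := ler_norm C; lra.
  by rewrite mulrC -ler_pdivlMr.
lra.
Qed.

(** Reversing the order of the sites exchanges the two off-diagonals and sends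
    the edge joining [n] and [n + 1] to the one joining [- n - 1] and [- n]. *)
Lemma quasimodes_reflection x l :
  has_quasimodes (matrix_operator
    (tridiagonal (fun n => ((x (- n - 1)).2, (x (- n - 1)).1)))) l ->
  has_quasimodes (matrix_operator (tridiagonal x)) l.
Proof.
set y := fun n => _; move=> qy e /qy[f [l2f l2g f1 ge]].
have E : matrix_operator (tridiagonal x) (f \o -%R) - l *: (f \o -%R) =
    (matrix_operator (tridiagonal y) f - l *: f) \o -%R.
  apply/funext => m.
  rewrite /= -[LHS]/(_ m - _ * f (- m)) -[RHS]/(_ (- m) - _ * f (- m)).
  congr (_ - _); rewrite !matrix_operator_tridiagonal /y /=.
  rewrite addrC; congr (_%:C * f _ + _%:C * f _); rewrite ?opprD ?opprK ?addrK//.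
exists (f \o -%R); rewrite E; split; rewrite /l2 /l2norm /= l2sum_opp//.
Qed.

(** The eigenvalue equation on a half-line, truncated: [f] copies [h] on the
    [N.+1] sites following [a]. The zero pair at [a] decouples them from the
    left, and [h 0 = 0] is the boundary condition there, so the equation fails
    only at the last site of the run and at the next one. *)
Lemma quasimode_on_run x (p : R * R) (a : int) (N : nat) (l : R[i]) (h : nat -> R[i]) :
  h 0%N = 0 -> h 1%N = 1 ->
  (forall k, p.1%:C * h k + p.2%:C * h k.+2 = l * h k.+1) ->
  x a = (0, 0) -> (forall j : nat, (0 < j <= N.+1)%N -> x (a + j%:Z) = p) ->
  exists f, let g := matrix_operator (tridiagonal x) f - l *: f in
    [/\ l2 f, l2 g, 1 <= l2norm f &
    l2norm g <= Normc.normc (p.2%:C * h N.+2) + Normc.normc (p.1%:C * h N.+1)].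
Proof.
move=> h0 h1 hrec xa xp.
pose f m := if a < m <= a + N.+1%:Z then h (absz (m - a)) else 0.
have fh k : (k <= N.+1)%N -> f (a + k%:Z) = h k.
  rewrite /f => kN; case: k kN => [|k] kN.
    by rewrite addr0 ltxx h0.
  by rewrite ifT; [congr h; lia|lia].
have f0 m : ~~ (a < m <= a + N.+1%:Z) -> f m = 0 by rewrite /f => /negbTE ->.
pose s := [seq a + k%:Z | k <- iota 1 N.+1].
have us : uniq s by rewrite map_inj_uniq ?iota_uniq// => i j; lia.
have fs m : m \notin s -> f m = 0.
  move=> ms; apply: f0; apply: contra ms => am.
  by apply/mapP; exists (absz (m - a)); rewrite ?mem_iota; lia.
set g := matrix_operator (tridiagonal x) f - l *: f.
have gE m : g m = (x (m - 1)).1%:C * f (m - 1) + (x m).2%:C * f (m + 1) - l * f m.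
  by rewrite -matrix_operator_tridiagonal.
have gN : g (a + N.+1%:Z) = - (p.2%:C * h N.+2).
  rewrite gE fh// [f (_ + 1)]f0 ?mulr0 ?addr0; last lia.
  have -> : a + N.+1%:Z - 1 = a + N%:Z by lia.
  rewrite fh// -hrec opprD addrA; case: N {f fh f0 s us fs g gE} xp => [|N] xp.
    by rewrite h0 !mulr0 subrr add0r.
  by rewrite xp ?subrr ?add0r//=; lia.
have gN1 : g (a + N.+2%:Z) = p.1%:C * h N.+1.
  rewrite gE [f (_ + 1)]f0; last lia.
  rewrite [f (a + N.+2%:Z)]f0; last lia.
  have -> : a + N.+2%:Z - 1 = a + N.+1%:Z by lia.
  by rewrite fh// xp ?leqnn//= !mulr0 subr0 addr0.
have g0 m : m != a + N.+1%:Z -> m != a + N.+2%:Z -> g m = 0.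
  move=> m1 m2; rewrite gE.
  have [ma|am] := ltP m a.
    by rewrite !f0 ?mulr0 ?addr0 ?subr0//; lia.
  have [mN|Nm] := ltP (a + N.+2%:Z) m.
    by rewrite !f0 ?mulr0 ?addr0 ?subr0//; lia.
  have [k mk] : exists k : nat, m = a + k%:Z by exists (absz (m - a)); lia.
  case: k mk => [|[|k]] mk.
  - rewrite mk addr0 xa /= [f (a - 1)]f0 ?[f a]f0 ?mulr0 ?mul0r ?addr0 ?subr0//; lia.
  - have -> : m - 1 = a + 0%N%:Z by lia.
    have -> : m + 1 = a + 2%N%:Z by lia.
    rewrite mk !fh; try lia.
    by rewrite h0 (xp 1%N) /=; [rewrite -hrec h0 !mulr0 subrr|lia].
  - have -> : m - 1 = a + k.+1%:Z by lia.
    have -> : m + 1 = a + k.+3%:Z by lia.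
    rewrite mk !fh; try lia.
    by rewrite (xp k.+1) ?(xp k.+2) /=; [rewrite -hrec subrr|lia|lia].
exists f => /=; rewrite -/g; split.
- exact: l2_finite_support us fs.
- apply: (@l2_finite_support _ [:: a + N.+1%:Z; a + N.+2%:Z]).
    by rewrite /= inE; lia.
  by move=> n; rewrite !inE negb_or => /andP[]; exact: g0.
- have <- : Normc.normc (f (a + 1%N%:Z)) = 1 by rewrite fh// h1 Normc.normc1.
  by apply: (l2norm_ge us fs); apply/mapP; exists 1%N; rewrite // mem_iota.
- rewrite -(normcN (p.2%:C * _)) -gN -gN1; apply: l2norm_pair_le; [lia|exact: g0].
Qed.
End l2.

(** * The constant-coefficient recurrence *)

Section decay.
Context (R : realType).

(** The solution with initial values 0 and 1 of the recurrence whose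
    characteristic roots are [r] and [s]: its value at [k] is the sum of
    [r ^+ i * s ^+ j] over [i + j = k - 1]. This recursive form also covers a
    double root. *)
Fixpoint char_solution (r s : R[i]) (k : nat) : R[i] :=
  if k is j.+1 then s * char_solution r s j + r ^+ j else 0.

Lemma char_solution_rec r s k :
  r * s * char_solution r s k + char_solution r s k.+2 =
  (r + s) * char_solution r s k.+1.
Proof. by rewrite /= exprS; ring. Qed.

Lemma normc_exp (z : R[i]) n : Normc.normc (z ^+ n) = Normc.normc z ^+ n.
Proof.
elim: n => [|n IH]; first by rewrite !expr0 Normc.normc1.
by rewrite !exprS Normc.normcM IH.
Qed.

(** If [rho] bounds the moduli of both roots and [rho < t < 1], then
    [(t - rho) * |h k| <= t ^+ k] is stable under the recursion
    [h k.+1 = s * h k + r ^+ k]. *)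
Lemma char_solution_decay r s : Normc.normc r < 1 -> Normc.normc s < 1 ->
  forall e : R, 0 < e -> exists N, forall k, (N <= k)%N ->
    Normc.normc (char_solution r s k) <= e.
Proof.
move=> r1 s1 e e0.
pose rho := Num.max (Normc.normc r) (Normc.normc s).
have rrho : Normc.normc r <= rho by rewrite le_max lexx.
have srho : Normc.normc s <= rho by rewrite le_max lexx orbT.
have rho0 : 0 <= rho by rewrite (le_trans _ rrho)// normc_ge0.
have rho1 : rho < 1 by rewrite gt_max r1.
pose t := (1 + rho) / 2.
have rt : rho < t by rewrite /t; lra.
have t1 : t < 1 by rewrite /t; lra.
have t0 : 0 < t by rewrite /t; lra.
have bnd k : (t - rho) * Normc.normc (char_solution r s k) <= t ^+ k.
  elim: k => [|k IH].
    rewrite -[char_solution r s 0]/(0 : R[i]) Normc.normc0 mulr0 expr0.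
    exact: ler01.
  have rk : Normc.normc (r ^+ k) <= t ^+ k.
    by rewrite normc_exp lerXn2r ?nnegrE ?normc_ge0 ?(ltW t0) ?(le_trans rrho (ltW rt)).
  have hk : Normc.normc (char_solution r s k.+1) <=
      rho * Normc.normc (char_solution r s k) + t ^+ k.
    apply: le_trans (le_normcD _ _) _; apply: lerD => //.
    by rewrite Normc.normcM ler_wpM2r ?normc_ge0.
  rewrite exprS; have tr0 : 0 <= t - rho by rewrite subr_ge0 ltW.
  apply: (le_trans (ler_wpM2l tr0 hk)).
  have := ler_wpM2l rho0 IH; nra.
have : (fun n => t ^+ n) @ \oo --> (0 : R) by apply: cvg_expr; rewrite gtr0_norm.
move=> /cvgrPdist_le /(_ (e * (t - rho))) /(_ _)[].
  by rewrite mulr_gt0// subr_gt0.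
move=> N _ tN; exists N => k /tN; rewrite /= sub0r normrN.
rewrite (ger0_norm (exprn_ge0 k (ltW t0))) => tk.
rewrite -(ler_pM2l (_ : 0 < t - rho)) ?subr_gt0//.
by apply: le_trans (bnd k) _; rewrite [leRHS]mulrC.
Qed.
End decay.

(** * The region enclosed by the ellipse *)

Section interior.
Context (R : realType).
Implicit Types (p : R * R) (z l r s : R[i]).

Lemma normcE_C z : `|z| = (Normc.normc z)%:C.
Proof. by case: z. Qed.

Lemma normc_real (a : R) : Normc.normc a%:C = `|a|.
Proof. by rewrite /Normc.normc/= expr0n addr0 sqrtr_sqr. Qed.

Lemma continuous_real_complex : continuous (fun u : R => u%:C : R[i]^o).
Proof.
move=> u; apply/cvgrPdist_lt => e e0.
have [e' e'0 ee] : exists2 e' : R, 0 < e' & e = e'%:C.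
  move: e0; rewrite ltcE/= => /andP[/eqP ie re].
  by exists (complex.Re e) => //; case: e ie re => a b /= -> _.
near=> v; rewrite -rmorphB normcE_C normc_real ee ltcR.
near: v; exact: (@cvgr_dist_lt _ _ _ _ _ id u).
Unshelve. all: by end_near. Qed.

Lemma expi_surj z : Normc.normc z = 1 -> exists2 t, t \in `[0, 2 * pi] & expi t = z.
Proof.
case: z => a b /= /(congr1 (fun u => u ^+ 2)).
rewrite sqr_sqrtr ?addr_ge0 ?sqr_ge0// expr1n => ab.
have a1 : -1 <= a <= 1 by nra.
have b2 : b ^+ 2 = 1 - a ^+ 2 by lra.
have sa : sin (acos a) = `|b| by rewrite sin_acos// -b2 sqrtr_sqr.
have [b0|b0] := leP 0 b.
  exists (acos a).
    rewrite in_itv/= acos_ge0//= (le_trans (acos_lepi _))//.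
    have := pi_ge0 R; lra.
  by rewrite /expi acosK ?in_itv// sa ger0_norm.
exists (2 * pi - acos a).
  rewrite in_itv/=; have := acos_ge0 a1; have := acos_lepi a1; have := pi_ge0 R; lra.
rewrite /expi cosB sinB mulr_natl cos2pi sin2pi acosK ?in_itv// sa ltr0_norm//.
by congr (_ +i* _); ring.
Qed.

Lemma normc_expi (t : R) : Normc.normc (expi t) = 1.
Proof. by rewrite /expi /Normc.normc cos2Dsin2 sqrtr1. Qed.

Lemma expiN (t : R) : expi (- t) = (expi t)^-1.
Proof.
apply: (mulfI (_ : expi t != 0)).
  apply/eqP => t0; have := normc_expi t; rewrite t0 Normc.normc0; lra.
rewrite divff; last first.
  apply/eqP => t0; have := normc_expi t; rewrite t0 Normc.normc0; lra.
rewrite /expi cosN sinN; apply/eqP; rewrite eq_complex/=; apply/andP; split; apply/eqP.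
  by have := cos2Dsin2 t; rewrite !expr2; lra.
by ring.
Qed.

Lemma ellipseP p l : ellipse p l <->
  exists2 z, Normc.normc z = 1 & l = p.1%:C * z + p.2%:C * z^-1.
Proof.
split=> [[t _ <-]|[z /expi_surj[t tI <-] ->]].
  by exists (expi t); [exact: normc_expi|rewrite expiN].
by exists t => //; rewrite expiN.
Qed.

(** The fibres of the Joukowski map [z |-> z + r / z] are the pairs
    [{S, r / S}]. *)
Lemma joukowski_eq (z S r : R[i]) : z != 0 -> S != 0 ->
  z + r * z^-1 = S + r * S^-1 -> z = S \/ z = r * S^-1.
Proof.
move=> z0 S0 E.
have : (z - S) * (z - r * S^-1) = 0.
  have -> : (z - S) * (z - r * S^-1) = z * (z + r * z^-1 - (S + r * S^-1)).
    by field; rewrite z0 S0.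
  by rewrite E subrr mulr0.
by move=> /eqP; rewrite mulf_eq0 !subr_eq0 => /orP[] /eqP; [left|right].
Qed.

(** A path that starts in the complement of [E] and runs off to infinity there
    keeps its starting point out of every bounded component. *)
Lemma unbounded_component (E : set R[i]) (phi : R -> R[i]) :
  continuous (phi : R -> R[i]^o) -> (forall u, 0 <= u -> ~ E (phi u)) ->
  (forall M, exists2 u, 0 <= u & M < Normc.normc (phi u)) ->
  ~ enclosed_region E (phi 0).
Proof.
move=> cphi Ephi phi_oo [_ [M [Mreal bM]]].
have [u u0 Mu] := phi_oo (complex.Re M + 1).
have phiu : connected_component (~` E : set R[i]^o) (phi 0) (phi u).
  exists (phi @` `[0, +oo[%classic); last by exists u => //=; rewrite in_itv/= u0.
  split.
  - by exists 0 => //=; rewrite in_itv/= lexx.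
  - by move=> _ [v /= + <-]; rewrite in_itv/= andbT => /Ephi.
  - apply: connected_continuous_connected.
      by apply/connected_intervalP; exact: interval_is_interval.
    exact: continuous_subspaceT.
have /bM /(_ _ phiu) /= : M < (complex.Re M + 1)%:C.
  have [M0] := RIm_real Mreal.
  by rewrite ltcE/= M0 eqxx ltrDl ltr01.
rewrite normcE_C lecR; lra.
Qed.

Lemma quadratic_roots (b c : R[i]) : exists r s, r + s = b /\ r * s = c.
Proof.
pose q := sqrtC (b ^+ 2 - 4 * c).
have qE : q ^+ 2 = b ^+ 2 - 4 * c by exact: sqrtCK.
exists ((b + q) / 2), ((b - q) / 2); split; first by field.
have -> : (b + q) / 2 * ((b - q) / 2) = (b ^+ 2 - q ^+ 2) / 4 by field.
by rewrite qE; field.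
Qed.

(** Here [r] and [s] are the roots of the characteristic polynomial of the
    recurrence [p.1 * h k + p.2 * h k.+2 = l * h k.+1]; equivalently
    [l = p.2 * (s + (r * s) / s)] is the value at [s] (or at [r]) of a Joukowski
    map that sends the unit circle onto the ellipse. A root on the unit circle
    would put [l] on the curve. If the circle separated the roots, the path
    [phi u = p.2 * (e^u * s + e^-u * r)], [u >= 0], would lead from [l] to
    infinity: the preimages [e^u * s] and [e^-u * r] of [phi u] stay on their
    sides of the circle, so [phi u] is never on the ellipse. *)
Lemma enclosed_region_roots p l : 0 < p.1 -> 0 < p.2 ->
  enclosed_region (ellipse p) l ->
  exists r s, [/\ p.2%:C * (r + s) = l, p.2%:C * (r * s) = p.1%:C &
    Normc.normc r < 1 /\ Normc.normc s < 1 \/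
    1 < Normc.normc r /\ 1 < Normc.normc s].
Proof.
move=> x0 y0 El.
have yC0 : p.2%:C != 0 :> R[i] by rewrite (fmorph_eq0 (real_complex R)) gt_eqF.
have xC0 : p.1%:C != 0 :> R[i] by rewrite (fmorph_eq0 (real_complex R)) gt_eqF.
have [r [s [rs_sum rs_prod]]] := quadratic_roots (l / p.2%:C) (p.1%:C / p.2%:C).
have lE : p.2%:C * (r + s) = l by rewrite rs_sum mulrC divfK.
have xE : p.2%:C * (r * s) = p.1%:C by rewrite rs_prod mulrC divfK.
exists r, s; split=> //.
wlog rs : r s rs_sum rs_prod lE xE / Normc.normc r <= Normc.normc s.
  move=> W; have [rs|/ltW sr] := leP (Normc.normc r) (Normc.normc s).
    exact: (W r s).
  have [] : Normc.normc s < 1 /\ Normc.normc r < 1 \/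
      1 < Normc.normc s /\ 1 < Normc.normc r.
    by apply: W; rewrite // ?(addrC s) ?(mulrC s).
  - by case=> ? ?; left.
  - by case=> ? ?; right.
have rs0 : r * s != 0 by rewrite rs_prod mulf_neq0// invr_neq0.
have [r0 s0] : r != 0 /\ s != 0 by apply/andP; rewrite -negb_or -mulf_eq0.
have on_curve z w : z != 0 -> z * w = r * s -> p.2%:C * (z + w) = l ->
    Normc.normc z <> 1.
  move=> z0 zw lz z1; case: El => + _; apply; apply/ellipseP; exists z^-1.
    by rewrite Normc.normcV z1 invr1.
  by rewrite invrK -lz -xE -zw; field.
have r1 : Normc.normc r <> 1 by exact: (on_curve r s).
have s1 : Normc.normc s <> 1.
  by apply: (on_curve s r) => //; rewrite ?(mulrC s) ?(addrC s).
have [r_lt|r_ge] := ltP (Normc.normc r) 1; last first.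
  have r_gt : 1 < Normc.normc r by rewrite lt_neqAle eq_sym r_ge andbT; apply/eqP.
  by right; split => //; exact: lt_le_trans rs.
have [s_lt|s_ge] := ltP (Normc.normc s) 1; first by left.
have s_gt : 1 < Normc.normc s by rewrite lt_neqAle eq_sym s_ge andbT; apply/eqP.
exfalso.
pose phi (u : R) : R[i] := p.2%:C * ((expR u)%:C * s + (expR (- u))%:C * r).
have phi0 : phi 0 = l by rewrite /phi oppr0 expR0 !mul1r addrC lE.
have normS u : Normc.normc ((expR u)%:C * s) = expR u * Normc.normc s.
  by rewrite Normc.normcM normc_real gtr0_norm// expR_gt0.
have normR u : Normc.normc ((expR (- u))%:C * r) = expR (- u) * Normc.normc r.
  by rewrite Normc.normcM normc_real gtr0_norm// expR_gt0.
have normS_gt u : 0 <= u -> 1 + u < expR u * Normc.normc s.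
  move=> u0; have := expR_ge1Dx u; have := expR_gt0 u; nra.
have normR_lt u : 0 <= u -> expR (- u) * Normc.normc r < 1.
  move=> u0; have : expR (- u) <= 1 by rewrite -expR0 ler_expR; lra.
  have := expR_gt0 (- u); have := normc_ge0 r; nra.
have expC0 u : (expR u)%:C != 0 :> R[i].
  by rewrite (fmorph_eq0 (real_complex R)) gt_eqF// expR_gt0.
apply: (@unbounded_component (ellipse p) phi); last by rewrite phi0.
- have ce : continuous (fun u : R => (expR u)%:C : R[i]^o).
    move=> u; apply: (@continuous_comp _ _ _ expR (fun v : R => v%:C : R[i]^o)).
      exact: continuous_expR.
    exact: continuous_real_complex.
  move=> u; apply: cvgM; first exact: cvg_cst.
  apply: cvgD; apply: cvgM; try exact: cvg_cst; first exact: ce.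
  apply: (@continuous_comp _ _ _ -%R (fun v : R => (expR v)%:C : R[i]^o)).
    exact: opp_continuous.
  exact: ce.
- move=> u u0 /ellipseP[z z1].
  have z0 : z != 0 by apply/eqP => z0; move: z1; rewrite z0 Normc.normc0; lra.
  have eNu : (expR (- u))%:C = (expR u)%:C^-1 :> R[i] by rewrite expRN fmorphV.
  rewrite /phi -xE eNu => E.
  have E' : z^-1 + (r * s) * z^-1^-1 =
      (expR u)%:C * s + (r * s) * ((expR u)%:C * s)^-1.
    apply: (mulfI yC0); rewrite invrK.
    transitivity (p.2%:C * (r * s) * z + p.2%:C * z^-1); first by ring.
    by rewrite -E; field; rewrite s0 expC0.
  have z1' : Normc.normc z^-1 = 1 by rewrite Normc.normcV z1 invr1.
  have [zS|zR] := joukowski_eq (invr_neq0 z0) (mulf_neq0 (expC0 u) s0) E'.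
    by have := normS_gt u u0; rewrite -normS -zS z1'; lra.
  have : z^-1 = (expR (- u))%:C * r by rewrite zR eNu; field; rewrite s0 expC0.
  by move=> zR'; have := normR_lt u u0; rewrite -normR -zR' z1' ltxx.
- move=> M; exists (`|M| / p.2); first by rewrite divr_ge0// ltW.
  set u := `|M| / p.2; have u0 : 0 <= u by rewrite divr_ge0// ltW.
  have Mu : M <= p.2 * u by rewrite mulrC divfK ?gt_eqF// ler_norm.
  apply: (le_lt_trans Mu); rewrite /phi Normc.normcM normc_real gtr0_norm// ltr_pM2l//.
  have := le_normcD ((expR u)%:C * s + (expR (- u))%:C * r) (- ((expR (- u))%:C * r)).
  rewrite addrK normcN normS normR; have := normS_gt u u0; have := normR_lt u u0; lra.
Qed.
End interior.

(** * The operator of a fixed sequence of coefficients *)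

Section deterministic.
Context (R : realType).
Implicit Types (x : int -> R * R) (p : R * R) (l r s : R[i]).

Lemma quasimodes_of_runs x p l r s : 0 < p.1 -> 0 < p.2 ->
  p.2%:C * (r + s) = l -> p.2%:C * (r * s) = p.1%:C ->
  Normc.normc r < 1 -> Normc.normc s < 1 ->
  (forall N : nat, exists2 a : int, x a = (0, 0) &
    forall j : nat, (0 < j <= N)%N -> x (a + j%:Z) = p) ->
  has_quasimodes (matrix_operator (tridiagonal x)) l.
Proof.
move=> p1 p2 lE xE r1 s1 runs e e0.
have p12 : 0 < p.1 + p.2 by rewrite addr_gt0.
have [|N hN] := char_solution_decay r1 s1 (e := e / (p.1 + p.2)).
  by rewrite divr_gt0.
have [a xa xp] := runs N.+1.
have hrec k : p.1%:C * char_solution r s k + p.2%:C * char_solution r s k.+2 =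
    l * char_solution r s k.+1.
  by rewrite -lE -[RHS]mulrA -char_solution_rec -xE; ring.
have h0 : char_solution r s 0 = 0 by [].
have h1 : char_solution r s 1 = 1 by rewrite /= mulr0 add0r expr0.
have [f [l2f l2g f1 gle]] := quasimode_on_run h0 h1 hrec xa xp.
exists f; split=> //; apply: (le_trans gle).
rewrite !Normc.normcM !normc_real !gtr0_norm//.
have -> : e = p.2 * (e / (p.1 + p.2)) + p.1 * (e / (p.1 + p.2)).
  by field; rewrite gt_eqF.
by apply: lerD; rewrite ler_pM2l//; apply: hN; lia.
Qed.

(** With both roots inside the unit circle the solution vanishing at the left
    end of a run decays to the right. With both outside, the reflected recurrence
    has the inverse roots, and the solution is started at the right end. *)
Lemma enclosed_region_in_spectrum x p : 0 < p.1 -> 0 < p.2 ->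
  (forall N : nat, exists2 a : int, x a = (0, 0) &
    forall j : nat, (0 < j <= N)%N -> x (a + j%:Z) = p) ->
  (forall N : nat, exists2 b : int, x b = (0, 0) &
    forall j : nat, (0 < j <= N)%N -> x (b - j%:Z) = p) ->
  enclosed_region (ellipse p) `<=` spectrum (matrix_operator (tridiagonal x)).
Proof.
move=> p1 p2 runs runs' l /(enclosed_region_roots p1 p2)[r [s [lE xE]]].
have p2C : p.2%:C != 0 :> R[i] by rewrite (fmorph_eq0 (real_complex R)) gt_eqF.
have : p.1%:C != 0 :> R[i] by rewrite (fmorph_eq0 (real_complex R)) gt_eqF.
rewrite -xE mulf_eq0 (negbTE p2C) orFb mulf_eq0 negb_or => /andP[r0 s0].
move=> [[r1 s1]|[r1 s1]]; apply: quasimodes_in_spectrum.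
  exact: (quasimodes_of_runs p1 p2 lE xE).
apply: quasimodes_reflection.
apply: (@quasimodes_of_runs _ (p.2, p.1) l r^-1 s^-1) => //=.
- by rewrite -lE -xE; field; rewrite r0 s0.
- by rewrite -xE; field; rewrite r0 s0.
- by rewrite Normc.normcV invf_lt1// (lt_trans _ r1).
- by rewrite Normc.normcV invf_lt1// (lt_trans _ s1).
- move=> N; have [b xb xp] := runs' N; exists (- b - 1).
    by rewrite (_ : - (- b - 1) - 1 = b) ?xb//; lia.
  move=> j jN; have -> : - (- b - 1 + j%:Z) - 1 = b - j%:Z by lia.
  by rewrite xp.
Qed.

(** Two zero pairs isolate a finite segment of sites on which the eigenvector is
    not identically zero. The matrix of the segment is symmetric with respect
    to a positive weight [D], because the two off-diagonal entries of each edge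
    are both zero or both positive. Reality then follows from a discrete flux
    identity: [Im l] times the weighted mass of the first sites of the segment
    equals the flux across the edge that closes them, and this flux vanishes at
    the end of the segment. *)
Lemma eigenvalue_real x l :
  (forall n, x n = (0, 0) \/ 0 < (x n).1 /\ 0 < (x n).2) ->
  (forall M : nat, exists n : nat, x (M%:Z + n%:Z) = (0, 0)) ->
  (forall M : nat, exists n : nat, x (- M%:Z - n%:Z) = (0, 0)) ->
  eigenvalues (matrix_operator (tridiagonal x)) l -> complex.Im l = 0.
Proof.
move=> xpos zr zl [f [_ f0 Tf]].
have [m fm] : exists m, f m != 0.
  apply: contrapT => /forallNP h; apply: f0; apply/funext => m.
  by apply/eqP; have /negP := h m; rewrite negbK.
have [na xna] := zl `|m|.+1%N; have [nb xnb] := zr `|m|%N.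
set a : int := - _ - _ in xna; set b : int := _ + _ in xnb.
pose g k := f (a + 1 + k%:Z); pose y k := x (a + 1 + k%:Z).
(* At [k = 0] the first term is zero, because [x a] is. *)
have eqn k : (x (a + k%:Z)).1%:C * f (a + k%:Z) + (y k).2%:C * g k.+1 = l * g k.
  rewrite -[RHS](_ : (l *: f) (a + 1 + k%:Z) = _)// -Tf.
  rewrite matrix_operator_tridiagonal /y /g.
  by congr (_.1%:C * f _ + _ * f _); [congr x|..]; lia.
have ypos k : y k = (0, 0) \/ 0 < (y k).1 /\ 0 < (y k).2 by exact: xpos.
have [D [D0 Dsym]] : exists D : nat -> R, (forall k, 0 < D k) /\
    forall k, D k * (y k).2 = D k.+1 * (y k).1.
  pose D := fix D k : R := if k is j.+1 then
    (if (y j).1 == 0 then D j else D j * ((y j).2 / (y j).1)) else 1.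
  exists D; split=> k.
    elim: k => [|k IH] /=; first exact: ltr01.
    by case: (ypos k) => [->|[y1 y2]]; rewrite ?eqxx// gt_eqF// mulr_gt0// divr_gt0.
  rewrite /=; case: (ypos k) => [->|[y1 y2]]; first by rewrite eqxx !mulr0.
  by rewrite gt_eqF// -mulrA divfK// gt_eqF.
pose p k := complex.Re (g k); pose q k := complex.Im (g k).
(* [D n * (y n).2] is the symmetrised entry of the edge from [n] to [n.+1], and
   the last factor is the imaginary part of [g n.+1 * (g n)^*]. *)
have flux n : complex.Im l * \sum_(k < n.+1) D k * (p k ^+ 2 + q k ^+ 2) =
    D n * (y n).2 * (q n.+1 * p n - p n.+1 * q n).
  have reim k (u v : R) (z : R[i]) : u%:C * z + v%:C * g k.+1 = l * g k ->
     complex.Im l * (p k ^+ 2 + q k ^+ 2) =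
       u * (complex.Im z * p k - complex.Re z * q k) +
       v * (q k.+1 * p k - p k.+1 * q k).
    move=> E; have := congr1 (@complex.Re R) E; have := congr1 (@complex.Im R) E.
    rewrite /p /q; case: (l) (z) (g k) (g k.+1) => [lr li] [zr' zi] [gr gi] [hr hi] /=.
    move=> E1 E2.
    have -> : li * (gr ^+ 2 + gi ^+ 2) =
        (lr * gi + li * gr) * gr - (lr * gr - li * gi) * gi.
      by ring.
    by rewrite -E1 -E2; ring.
  elim: n => [|n IH].
    rewrite big_ord_recr big_ord0 /= add0r.
    have := eqn 0%N; rewrite addr0 xna mul0r add0r => E.
    rewrite mulrCA (reim 0%N 0 (y 0%N).2 0) /=; first by ring.
    by rewrite mul0r add0r.
  rewrite big_ord_recr /= mulrDr IH.
  have := eqn n.+1.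
  have -> : a + n.+1%:Z = a + 1 + n%:Z by lia.
  rewrite -/(y n) -/(g n) => /reim E.
  rewrite [_ * (D n.+1 * _)]mulrCA E (Dsym n).
  rewrite /p /q; ring.
have [K Kb] : exists K : nat, b = a + 1 + K%:Z.
  by exists (absz ((b : int) - a - 1)%R); rewrite /a /b; lia.
have [k km] : exists2 k : 'I_K.+1, m = a + 1 + k%:Z & True.
  have kK : (absz (m - (a : int) - 1)%R < K.+1)%N by move: Kb; rewrite /a /b; lia.
  by exists (Ordinal kK) => //=; rewrite /a; lia.
move=> _; have := flux K; rewrite /y -Kb xnb /= mulr0 mul0r => /eqP.
rewrite mulf_eq0 => /orP[/eqP //|].
rewrite psumr_eq0; last first.
  by move=> i _; apply: mulr_ge0; [exact: ltW|rewrite addr_ge0 ?sqr_ge0].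
move=> /allP /(_ k (mem_index_enum _)) /=; rewrite mulf_eq0 gt_eqF//= => /eqP pq.
case/negP: fm; rewrite km -/(g k) eq_complex /= -/(p k) -/(q k).
have := sqr_ge0 (p k); have := sqr_ge0 (q k) => q0 p0.
by apply/andP; split; rewrite -sqrf_eq0; apply/eqP; lra.
Qed.
End deterministic.

(** * The random operator *)

Theorem theorem9 (R : realType) (mu : probability (R * R)%type R)
    (F : set (R * R))
    (F_finite : finite_set F)
    (F_support : support_of mu = F)
    (F_zero : F (0, 0))
    (F_pos : forall p : R * R, F p -> p <> (0, 0) -> 0 < p.1 /\ 0 < p.2)
    (d : measure_display) (Omega : measurableType d) (P : probability Omega R)
    (X : int -> {RV P >-> (R * R)%type})
    (X_indep : mutually_independent X)
    (X_law : forall n : int, has_law (X n) mu) :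
  let A (w : Omega) := matrix_operator (tridiagonal (fun n => X n w)) in
  {ae P, forall w, forall l : R[i], eigenvalues (A w) l -> complex.Im l = 0} /\
  {ae P, forall w, forall p : R * R, F p -> p <> (0, 0) ->
     enclosed_region (ellipse p) `<=` spectrum (A w)}.
Proof.
move=> A.
have atom q : F q -> (0 < mu [set q])%E.
  by rewrite -F_support; apply: support_atom; rewrite F_support.
have X_in_F n : {ae P, forall w, F (X n w)}.
  have [N [mN N0 FN]] := negligible_setC_support mu.
  exists (X n @^-1` N); split.
  - exact: measurable_funPTI.
  - by apply: etrans N0; exact: (X_law n N mN).
  - by move=> w /= nF; apply: FN; rewrite F_support.
split.
- have X_in : {ae P, forall w, forall n : nat, F (X n%:Z w) /\ F (X (- n%:Z) w)}.
    by apply: ae_foralln => n; apply: filterI; exact: X_in_F.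
  have zero (e : nat -> nat -> int) : (forall M, injective (e M)) ->
      {ae P, forall w, forall M, exists n, X (e M n) w = (0, 0)}.
    move=> einj; apply: ae_foralln => M.
    have zero_atom q : q \in [:: (0, 0)] -> (0 < mu [set q])%E.
      by rewrite inE => /eqP ->; exact: atom.
    have := recurrent_pattern X_indep X_law (einj M) zero_atom.
    apply: filterS => w [n /(_ 0%N isT)]; rewrite addn0 => Xn; by exists n.
  have zr := zero (fun M n => M%:Z + n%:Z) (fun M n n' => ltac:(lia)).
  have zl := zero (fun M n => - M%:Z - n%:Z) (fun M n n' => ltac:(lia)).
  apply: filterS3 X_in zr zl => w Xw zrw zlw l; apply: eigenvalue_real => // n.
  have FX : F (X n w).
    by case: n => n; [exact: (Xw n).1|rewrite NegzE; exact: (Xw n.+1).2].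
  by have [->|/eqP] := eqVneq (X n w) (0, 0); [left|right; exact: F_pos].
(* Points of [F] are numbered, so that one almost sure event serves all of them;
   indices past the end of [s] give the point (0, 0), which is in [F] too. *)
- have [s Fs] := (finite_seqP _).1 F_finite.
  have Fnth i : F (nth (0, 0) s i).
    have [i_lt|i_ge] := ltnP i (size s); last by rewrite nth_default.
    by rewrite Fs /=; exact: mem_nth.
  have run (e : nat -> int) : injective e ->
      {ae P, forall w, forall i N : nat, exists a : nat, X (e a) w = (0, 0) /\
        forall j, (0 < j <= N)%N -> X (e (a + j)%N) w = nth (0, 0) s i}.
    move=> einj; apply: ae_foralln => i; apply: ae_foralln => N.
    have run_atom q :
        q \in (0, 0) :: nseq N (nth (0, 0) s i) -> (0 < mu [set q])%E.
      by rewrite inE => /orP[/eqP -> |/nseqP[-> _]]; exact: atom.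
    have := recurrent_pattern X_indep X_law einj run_atom.
    apply: filterS => w [a Xa]; exists a; split.
      by have /= := Xa 0%N isT; rewrite addn0.
    by case=> // j /= jN; rewrite Xa/= ?size_nseq// nth_nseq jN.
  have right_runs := run (fun n => n%:Z) (fun n n' => ltac:(lia)).
  have left_runs := run (fun n => - n%:Z) (fun n n' => ltac:(lia)).
  apply: filterS2 right_runs left_runs => w Xr Xl p; rewrite {1}Fs /= => ps p0.
  have pF : F p by rewrite Fs.
  have [p1 p2] := F_pos _ pF p0.
  apply: enclosed_region_in_spectrum => // N.
  + have [a [Xa Xp]] := Xr (index p s) N; rewrite nth_index// in Xp.
    by exists a%:Z => // j jN; rewrite -PoszD Xp.
  + have [a [Xa Xp]] := Xl (index p s) N; rewrite nth_index// in Xp.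
    by exists (- a%:Z) => // j jN; rewrite -opprD -PoszD Xp.
Qed.
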